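(* Let $\Phi$ be any admissible function. (i) The dimension $\overline{\dim}^\Phi$ is finitely stable: for all non-empty totally bounded subsets $E,F$ of a uniformly perfect metric space $X$ with more than one point, $$\overline{\dim}^\Phi(E\cup F)=\max\{\overline{\dim}^\Phi E,\overline{\dim}^\Phi F\}.$$ (ii) The dimension $\underline{\dim}^\Phi$ is not finitely stable: there exist (non-empty) compact sets $E,F\subset\mathbb{R}$ such that $$\underline{\dim}^\Phi(E\cup F)>\max\{\underline{\dim}^\Phi E,\underline{\dim}^\Phi F\}.$$
   Context: For a subset $U$ of a metric space, $|U|$ denotes its diameter, and $B(x,r)$ is the open ball. Convention: $\inf\varnothing=\infty$; dimensions take values in $[0,\infty]$. A metric space $X$ is uniformly perfect if there is $c\in(0,1)$ such that $B(x,R)\setminus B(x,cR)\neq\varnothing$ for all $x\in X$ and $0<R<|X|$. A set $F$ is totally bounded if for every $\delta>0$ it can be covered by finitely many open balls of radius $\delta/2$ with centres in $F$. $\mathbb{R}$ carries the Euclidean metric. A function $\Phi\colon(0,\Delta)\to\mathbb{R}$ (for some $\Delta>0$) is admissible if it is monotonic, $0<\Phi(\delta)\le\delta$ for all $\delta\in(0,\Delta)$, and $\Phi(\delta)/\delta\to0$ as $\delta\to0^+$. For a non-empty totally bounded $F\subseteq X$ and admissible $\Phi$, the upper $\Phi$-intermediate dimension $\overline{\dim}^\Phi F$ is the infimum of all $s\ge0$ such that for all $\epsilon>0$ there exists $\delta_0\in(0,1]$ (with $(0,\delta_0)$ contained in the domain of $\Phi$) such that for all $\delta\in(0,\delta_0)$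 there is a finite or countable cover $\{U_1,U_2,\dots\}$ of $F$ by subsets of $X$ with $\Phi(\delta)\le|U_i|\le\delta$ for all $i$ and $\sum_i|U_i|^s\le\epsilon$. The lower $\Phi$-intermediate dimension $\underline{\dim}^\Phi F$ is the infimum of all $s\ge0$ such that for all $\epsilon>0$ and $\delta_0\in(0,1]$ there exist $\delta\in(0,\delta_0)$ (in the domain of $\Phi$) and such a cover of $F$ with $\Phi(\delta)\le|U_i|\le\delta$ for all $i$ and $\sum_i|U_i|^s\le\epsilon$. *)

(* Defs.v *)
From HB Require Import structures.
From mathcomp Require Import all_boot all_order all_algebra.
From mathcomp Require Import all_classical all_reals all_analysis.

Set Implicit Arguments.
Unset Strict Implicit.
Unset Printing Implicit Defensive.

Import Order.TTheory GRing.Theory Num.Theory.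
Import numFieldNormedType.Exports.

Local Open Scope classical_set_scope.
Local Open Scope ring_scope.

Section MetricSpace.
Context {R : realType} {X : metricType R}.

(* Adjoining 0 makes the diameter of the empty set 0 instead of -oo. *)
Definition diameter (U : set X) : \bar R :=
  ereal_sup (0%E |` [set (mdist p.1 p.2)%:E | p in U `*` U]).

Definition totally_bounded (F : set X) : Prop :=
  forall delta : R, 0 < delta ->
    exists A : set X, [/\ finite_set A, A `<=` F &
      F `<=` \bigcup_(x in A) ball x (delta / 2)].

End MetricSpace.

Definition uniformly_perfect {R : realType} (X : metricType R) : Prop :=
  exists c : R, 0 < c < 1 /\
    forall (x : X) (r : R), 0 < r -> (r%:E < diameter [set: X])%E ->
      ball x r `\` ball x (c * r) !=set0.

(* A function on the interval (0, Delta) is represented by a total function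
   R -> R together with Delta; its values outside (0, Delta) are never used. *)
Definition admissible {R : realType} (Delta : R) (Phi : R -> R) : Prop :=
  [/\ 0 < Delta,
      {in `]0, Delta[ &, {homo Phi : x y / x <= y}} \/
        {in `]0, Delta[ &, {homo Phi : x y /~ x <= y}},
      {in `]0, Delta[, forall delta, 0 < Phi delta <= delta} &
      Phi delta / delta @[delta --> 0^'+] --> 0].

Section IntermediateDimensions.
Context {R : realType} {X : metricType R}.

(* The finite or countable cover is indexed by a set D of natural numbers. *)
Definition has_cover (F : set X) (a b s eps : R) : Prop :=
  exists (D : set nat) (U : nat -> set X),
    [/\ F `<=` \bigcup_(i in D) U i,
        forall i, D i -> (a%:E <= diameter (U i) <= b%:E)%E &
        (\esum_(i in D) (diameter (U i) `^ s) <= eps%:E)%E].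

Definition upper_intermediate_dim (Delta : R) (Phi : R -> R) (F : set X) :
    \bar R :=
  ereal_inf [set s%:E | s in [set s : R | 0 <= s /\
    forall eps : R, 0 < eps ->
      exists delta0 : R, [/\ 0 < delta0 <= 1, delta0 <= Delta &
        forall delta, 0 < delta < delta0 ->
          has_cover F (Phi delta) delta s eps]]].

Definition lower_intermediate_dim (Delta : R) (Phi : R -> R) (F : set X) :
    \bar R :=
  ereal_inf [set s%:E | s in [set s : R | 0 <= s /\
    forall eps delta0 : R, 0 < eps -> 0 < delta0 <= 1 ->
      exists delta : R, [/\ 0 < delta < delta0, delta < Delta &
        has_cover F (Phi delta) delta s eps]]].

End IntermediateDimensions.

(* Main.v *)
(* For (i), merge a cover of E with a cover of F at the same scale delta.

   For (ii), put e_(n+1) = Phi (e_n ^ 36) and let P_n be the set of multiples of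
   e_(n+2) in [0, e_n ^ 16]. The sets E and F are the unions of the P_n over
   even and odd n. At the scale delta = e_(n+2) ^ 16, the P_m with m <= n have
   at most e_(n+2) ^ -2 points in total, while P_(n+2), P_(n+4), ... all lie in a single
   interval of length delta: the set of the parity of n has lower dimension at
   most 1/4. When delta lies in [e_(n+1) ^ 36, e_n ^ 36], all covering sets have
   diameter at least Phi delta >= e_(n+2), so they do not see the gaps of P_n,
   which costs as much as an interval of length e_n ^ 16. These ranges of delta
   exhaust all small scales, so the union has lower dimension at least 1/2. *)
Require Import Defs.
From HB Require Import structures.
From mathcomp Require Import all_boot all_order all_algebra.
From mathcomp Require Import all_classical all_reals all_analysis.
From mathcomp Require Import zify ring lra.

Set Implicit Arguments.
Unset Strict Implicit.
Unset Printing Implicit Defensive.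

Import Order.TTheory GRing.Theory Num.Theory.
Import numFieldNormedType.Exports.

Local Open Scope classical_set_scope.
Local Open Scope ring_scope.

(** * Covers in an arbitrary metric space *)

Section Covers.
Context {R : realType} {X : metricType R}.
Implicit Types (E F U : set X) (a b s eps : R).

Lemma mdist_le_diameter U x y : U x -> U y -> ((mdist x y)%:E <= diameter U)%E.
Proof. by move=> Ux Uy; apply: ereal_sup_ubound; right; exists (x, y). Qed.

Lemma has_cover_subset E F a b s eps :
  E `<=` F -> has_cover F a b s eps -> has_cover E a b s eps.
Proof. by move=> EF [D [U [FU dU sU]]]; exists D, U; split=> // x /EF/FU. Qed.

(** All diameters lie in [[a, b]], hence in (0, 1], where a power decreases as its exponent grows:
    the same cover serves. *)
Lemma has_cover_le_exponent F a b s s' eps :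
  0 < a -> b <= 1 -> s <= s' -> has_cover F a b s eps -> has_cover F a b s' eps.
Proof.
move=> a0 b1 ss' [D [U [FU dU sU]]]; exists D, U; split => //.
apply: le_trans sU; apply: le_esum => i /dU.
case: (diameter (U i)) => [r| |];
  rewrite ?leeye_eq ?leeNe_eq ?andbF//= !lee_fin.
by move=> /andP[ar rb]; apply: ger_powR => //; lra.
Qed.

(** The two covers are interleaved, on even and odd indices, and the sum is split by parity. *)
Lemma has_coverU E F a b s eps1 eps2 :
  has_cover E a b s eps1 -> has_cover F a b s eps2 ->
  has_cover (E `|` F) a b s (eps1 + eps2).
Proof.
move=> [D1 [U1 [EU1 dU1 sU1]]] [D2 [U2 [FU2 dU2 sU2]]].
pose U i := if odd i then U2 i./2 else U1 i./2.
have U_even i : U i.*2 = U1 i by rewrite /U odd_double doubleK.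
have U_odd i : U i.*2.+1 = U2 i by rewrite /U /= odd_double /= uphalf_double.
exists ((fun i => i.*2) @` D1 `|` (fun i => i.*2.+1) @` D2), U; split.
- move=> x [/EU1[i Di Uix]|/FU2[i Di Uix]].
  + by exists i.*2; [left; exists i | rewrite U_even].
  + by exists i.*2.+1; [right; exists i | rewrite U_odd].
- by move=> _ [[i Di <-]|[i Di <-]]; rewrite ?U_even ?U_odd;
    [exact: dU1|exact: dU2].
rewrite (esumID [set i | ~~ odd i]); last by move=> *; exact: poweR_ge0.
rewrite EFinD; apply: leeD.
- rewrite (_ : _ `&` _ = (fun i => i.*2) @` D1).
    rewrite esum_image; last by move=> i j _ _ /double_inj.
    by under eq_esum do rewrite U_even.
  apply/seteqP; split=> [_ [[[i Di <-]|[i Di <-]]] //=|_ [i Di <-]].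
  + by exists i.
  + by rewrite odd_double.
  + by split; [left; exists i | rewrite /= odd_double].
- rewrite (_ : _ `&` _ = (fun i => i.*2.+1) @` D2).
    rewrite esum_image; last by move=> i j _ _ [] /double_inj.
    by under eq_esum do rewrite U_odd.
  apply/seteqP; split=> [_ [[[i Di <-]|[i Di <-]]] //=|_ [i Di <-]].
  + by rewrite odd_double.
  + by exists i.
  + by split; [right; exists i | rewrite /= odd_double].
Qed.

End Covers.

(** * Finite stability of the upper dimension *)

Section UpperDimension.
Context {R : realType} {X : metricType R} (Delta : R) (Phi : R -> R).
Hypothesis Phi_adm : admissible Delta Phi.
Implicit Types E F : set X.

Let udim := @upper_intermediate_dim R X Delta Phi.

Lemma upper_intermediate_dim_subset E F : E `<=` F -> (udim E <= udim F)%E.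
Proof.
move=> EF; apply: ereal_inf_le_tmp => _ [s [s0 Fs] <-]; exists s => //.
split=> // eps /Fs[d [d01 dD Fd]]; exists d; split=> // e /Fd.
exact: has_cover_subset.
Qed.

Lemma upper_intermediate_dimU E F :
  udim (E `|` F) = Order.max (udim E) (udim F).
Proof.
apply/eqP; rewrite eq_le; apply/andP; split; last first.
  by rewrite ge_max !upper_intermediate_dim_subset.
(* If both dimensions were smaller than that of the union, there would be valid exponents [s1] and
   [s2] below the latter; their maximum is valid for the union, a contradiction. *)
rewrite leNgt gt_max; apply/negP => /andP[].
move=> /ereal_inf_lt[_ [s1 [s10 E1] <-] l1].
move=> /ereal_inf_lt[_ [s2 [s20 F2] <-] l2].
suff: (udim (E `|` F) <= (Order.max s1 s2)%:E)%E.
  by apply/negP; rewrite -ltNge EFin_max gt_max l1.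
apply: ereal_inf_lbound; exists (Order.max s1 s2) => //.
split; first by rewrite le_max s10.
move=> eps eps0; have eps20 : 0 < eps / 2 by lra.
have [d1 [d101 d1D Ed1]] := E1 _ eps20.
have [d2 [d201 d2D Fd2]] := F2 _ eps20.
exists (Order.min d1 d2); split; first by rewrite lt_min ge_min; lra.
  by rewrite ge_min d1D.
move=> d; rewrite lt_min => /andP[d0 /andP[dd1 dd2]].
have [_ _ /(_ d) Phid _] := Phi_adm.
have Phid0 : 0 < Phi d by move: Phid; rewrite in_itv/= => /(_ ltac:(lra)); lra.
rewrite [eps]splitr; apply: has_coverU.
- apply: has_cover_le_exponent (Ed1 _ _) => //;
    [lra|by rewrite le_max lexx|lra].
- apply: has_cover_le_exponent (Fd2 _ _) => //;
    [lra|by rewrite le_max lexx orbT|lra].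
Qed.

End UpperDimension.

(** * Cost of covers on the real line *)

Section RealCovers.
Context {R : realType}.
Implicit Types (F : set R^o) (a b s eps delta : R).

Lemma diameter_itv (x delta : R) : 0 <= delta ->
  diameter (`[x, x + delta]%classic : set R^o) = delta%:E.
Proof.
move=> d0; apply/eqP; rewrite eq_le; apply/andP; split.
  apply: ge_ereal_sup => _ [->|[[y z] [/= yI zI] <-]]; rewrite lee_fin//.
  move: yI zI; rewrite /= !in_itv/= => yI zI.
  by rewrite ler_norml; lra.
have distE : @mdist _ R^o x (x + delta) = delta.
  by rewrite -[LHS]/(`|_|) addrAC subrr add0r ger0_norm.
rewrite -{1}distE; apply: mdist_le_diameter;
  by rewrite /= in_itv/= lexx lerDl d0.
Qed.

Lemma has_cover_itv F a delta s eps N (p : nat -> R) :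
  0 <= delta -> a <= delta -> N%:R * delta `^ s <= eps ->
  (forall x, F x -> exists2 i, (i < N)%N & p i <= x <= p i + delta) ->
  has_cover F a delta s eps.
Proof.
move=> d0 ad Neps Fp; exists `I_N, (fun i => `[p i, p i + delta]%classic).
split.
- by move=> x /Fp[i iN xi]; exists i => //=; rewrite in_itv.
- by move=> i _; rewrite diameter_itv// !lee_fin ad lexx.
under eq_esum do rewrite diameter_itv//.
rewrite esum_fset//; last by move=> *; exact: poweR_ge0.
rewrite -fsbig_ord; under eq_bigr do rewrite poweR_EFin.
by rewrite sumEFin lee_fin sumr_const card_ord -mulr_natl.
Qed.

(** Starting from its least element, [S] fits in a window of [d.+1] consecutive integers. *)
Lemma card_ord_le_span N (S : {set 'I_N}) (d : nat) :
  (forall j k, j \in S -> k \in S -> (j <= k + d)%N) -> (#|S| <= d.+1)%N.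
Proof.
case: (set_0Vmem S) => [->|[k0 Sk0] Sd]; first by rewrite cards0.
case: (arg_minnP (fun i : 'I_N => nat_of_ord i) Sk0) => k Sk kmin.
rewrite cardE -(size_map val) -(size_iota k d.+1).
apply: uniq_leq_size; first by
  rewrite map_inj_uniq ?enum_uniq//; exact: val_inj.
move=> _ /mapP[j + ->]; rewrite mem_enum => Sj.
by rewrite mem_iota kmin//= addnS ltnS Sd.
Qed.

(** The indices span at most the integer part of [r / h], so [#|S| * h <= r + h <= 2 * r]. *)
Lemma card_progression_le N (S : {set 'I_N}) (h r : R) : 0 < h -> h <= r ->
  (forall j k, j \in S -> k \in S -> `|k%:R * h - j%:R * h| <= r) ->
  #|S|%:R * h <= 2 * r.
Proof.
move=> h0 hr Sr; have rh0 : 0 <= r / h by apply: divr_ge0; lra.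
have /andP[trh _] := truncn_itv rh0.
have : (#|S| <= (Num.truncn (r / h)).+1)%N.
  apply: card_ord_le_span => j k Sj Sk; rewrite -leq_subLR truncn_ge_nat//.
  rewrite ler_pdivlMr//; have [jk|/ltnW kj] := leqP j k.
    by move: jk; rewrite -subn_eq0 => /eqP ->; lra.
  by rewrite natrB// mulrBl (le_trans _ (Sr _ _ Sj Sk))// distrC ler_norm.
rewrite -(ler_nat R) -(ler_pM2r h0) => /le_trans; apply.
have : (Num.truncn (r / h))%:R * h <= r by rewrite -ler_pdivlMr.
by rewrite -natr1 mulrDl mul1r; lra.
Qed.

(* Sets of diameter [r >= h] contain at most [2 r / h] terms of the
   progression, and [r <= b `^ (1 - s) * r `^ s] when [r <= b]. *)
Lemma progression_cover_cost F a b s eps (h : R) N : 0 < h -> h <= a ->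
  s <= 1 -> (forall j, (j < N)%N -> F (j%:R * h)) ->
  has_cover F a b s eps -> N%:R * h <= 2 * b `^ (1 - s) * eps.
Proof.
move=> h0 ha s1 FN [D [U [FU dU sU]]].
have f_ex (j : 'I_N) : {i | D i /\ U i (j%:R * h)}.
  by apply: cid; have [i Di Ui] := FU _ (FN j (ltn_ord j)); exists i.
(* Each term is assigned to one set containing it; [t] lists the sets used, and the fibres of [f]
   partition the [N] terms. *)
pose f j := sval (f_ex j); pose t := undup (codom f).
have tD i : i \in t -> D i.
  by rewrite mem_undup => /codomP[j ->]; case: (svalP (f_ex j)).
pose r i := fine (diameter (U i)).
have rE i : D i -> diameter (U i) = (r i)%:E.
  move=> /dU; rewrite /r; case: (diameter (U i)) => [//| |];
  by rewrite ?leeye_eq ?leeNe_eq ?andbF.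
have rab i : D i -> a <= r i <= b by move=> Di; have := dU i Di; rewrite rE.
have tcost : \sum_(i <- t) r i `^ s <= eps.
  rewrite -lee_fin -sumEFin; apply: le_trans sU; apply: esum_ge.
  exists [set` t]; first by split=> [|i /tD //]; exact: finite_seq.
  rewrite -fsbig_seq ?undup_uniq// le_eqVlt; apply/orP; left; apply/eqP.
  by apply: eq_big_seq => i /tD Di; rewrite rE.
have -> : N%:R * h = \sum_(i <- t) #|[set j | f j == i]%SET|%:R * h.
  rewrite -mulr_suml; congr (_ * h); rewrite -natr_sum; congr (_%:R).
  under eq_bigr do rewrite -sum1dep_card big_mkcond.
  rewrite exchange_big/= -[LHS]card_ord -sum1_card; apply: eq_bigr => j _.
  rewrite (bigD1_seq (f j)) ?undup_uniq//= ?eqxx ?addn0.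
    by rewrite big1 ?addn0// => i; rewrite eq_sym => /negPf ->.
  by rewrite mem_undup codom_f.
apply: le_trans (ler_wpM2l _ tcost); last by rewrite mulr_ge0// powR_ge0.
rewrite mulr_sumr big_seq [leRHS]big_seq; apply: ler_sum => i it.
have Di := tD i it; have /andP[ar rb] := rab i Di.
apply: (@le_trans _ _ (2 * r i)).
  apply: card_progression_le => //; first exact: le_trans ar.
  move=> j k; rewrite !inE => /eqP fj /eqP fk.
  have [_ Uj] := svalP (f_ex j); have [_ Uk] := svalP (f_ex k).
  rewrite -/(f j) fj in Uj; rewrite -/(f k) fk in Uk.
  by have := @mdist_le_diameter R R^o _ _ _ Uj Uk; rewrite rE// lee_fin.
rewrite -mulrA ler_pM2l//.
have r0 : 0 < r i := lt_le_trans h0 (le_trans ha ar).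
have {1}-> : r i = r i `^ (1 - s) * r i `^ s.
  by rewrite -powRD subrK ?powRr1 ?ltW ?oner_eq0.
rewrite ler_wpM2r ?powR_ge0// ge0_ler_powR ?nnegrE//; lra.
Qed.

End RealCovers.

(** A proper filter on [A] that does not cluster at [x] contains [A] minus some neighbourhood of
    [x], and has a cluster point in that compact set. *)
Lemma compact_tails_at (T : topologicalType) (A : set T) (x : T) :
  A x -> (forall V, nbhs x V -> compact (A `\` V)) -> compact A.
Proof.
move=> Ax Atail F PF FA; have [xF|] := pselect (cluster F x); first by exists x.
move=> /existsNP[B /existsNP[V /not_implyP[FB /not_implyP[xV BV0]]]].
have FAV : F (A `\` V).
  apply: filterS (filterI FA FB) => y [Ay By]; split=> // Vy.
  by apply: BV0; exists y.
by have [y [[Ay _] yF]] := Atail V xV F PF FAV; exists y.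
Qed.

(** * The sets E and F, for an abstract sequence of scales *)

Section SparseProgressions.
Context {R : realType} (e : nat -> R).
Hypothesis e_gt0 : forall n, 0 < e n.
Hypothesis e0_le : e 0%N <= 1 / 2.
Hypothesis e_half : forall n, e n.+1 <= e n / 2.

Definition progression n : set R^o :=
  [set x | x <= e n ^+ 16 /\ exists j : nat, x = j%:R * e n.+2].

Definition progressions (b : bool) : set R^o :=
  [set x | exists2 n, odd n = b & progression n x].

Let e_ge0 n : 0 <= e n.
Proof. exact: ltW. Qed.

Let e_le m n : (m <= n)%N -> e n <= e m.
Proof.
move=> /subnKC <-; elim: (n - m)%N => [|k IHk]; rewrite ?addn0// addnS.
by have := e_half (m + k); have := e_gt0 (m + k); lra.
Qed.

Let e_le_half n : e n <= 1 / 2.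
Proof. exact: le_trans (e_le (leq0n n)) e0_le. Qed.

(** Serves both to make [e n] tend to 0 and to absorb the number of progressions counted in
    [has_cover_progressions]. *)
Let e_linear n : n.+1%:R * e n <= 1.
Proof.
elim: n => [|n IHn]; first by have := e0_le; lra.
have := e_half n; have := ler0n R n; have := e_gt0 n.
rewrite -[n.+2%:R]natr1 -[n.+1%:R]natr1 in IHn *; nra.
Qed.

Let e_small r : 0 < r -> exists n0, forall n, (n0 <= n)%N -> e n < r.
Proof.
move=> r0; exists (Num.truncn r^-1) => n.
rewrite -ltnS truncn_lt_nat ?invr_ge0 ?ltW// -[r^-1]mul1r ltr_pdivrMr// => rn.
by rewrite -(ltr_pM2l (ltr0Sn R n)) (le_lt_trans (e_linear n)).
Qed.

Let eX_le n k : e n ^+ k.+1 <= e n.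
Proof.
rewrite exprS ler_piMr ?e_ge0// exprn_ile1 ?e_ge0//.
by have := e_le_half n; lra.
Qed.

Lemma progression_ge0 n x : progression n x -> 0 <= x.
Proof. by move=> [_ [j ->]]; rewrite mulr_ge0 ?e_ge0 ?ler0n. Qed.

Lemma progression_index n x : progression n x ->
  exists2 j, (j < Num.truncn (e n.+2)^-1)%N & x = j%:R * e n.+2.
Proof.
move=> [xn [j xj]]; exists j => //; rewrite truncn_gt_nat.
rewrite -[leRHS]mul1r ler_pdivlMr// -natr1 mulrDl mul1r -xj.
by have := eX_le n 15; have := e_le_half n; have := e_le_half n.+2; lra.
Qed.

Lemma finite_progression n : finite_set (progression n).
Proof.
apply: (@sub_finite_set _ _
  ((fun j => j%:R * e n.+2) @` `I_(Num.truncn (e n.+2)^-1))).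
  by move=> x /progression_index[j jn ->]; exists j.
exact/finite_image/finite_II.
Qed.

Lemma progressions0 b : progressions b 0.
Proof.
exists (b : nat); first by case: b.
by split; [rewrite exprn_ge0 ?ltW | exists 0%N; rewrite mul0r].
Qed.

(** Outside a ball around 0 only finitely many progressions, each finite, have points. *)
Lemma compact_progressions b : compact (progressions b).
Proof.
apply: (@compact_tails_at _ _ 0 (progressions0 b)) => V /nbhs_ballP[r /= r0 rV].
have [n0 en0] := e_small r0; apply: finite_compact.
apply: (@sub_finite_set _ _ (\bigcup_(n in `I_n0) progression n)).
  move=> x [[n _ nx] Vx]; exists n => //=.
  rewrite ltnNge; apply/negP => /en0 enr.
  apply/Vx/rV; rewrite -ball_normE/= sub0r normrN.
  rewrite ger0_norm ?(progression_ge0 nx)//.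
  case: nx => xn _; apply: le_lt_trans xn _.
  by apply: le_lt_trans (eX_le n 15) enr.
by apply: bigcup_finite => // n _; exact: finite_progression.
Qed.

Lemma has_cover_progressions b n a : odd n = b -> a <= e n.+2 ^+ 16 ->
  has_cover (progressions b) a (e n.+2 ^+ 16) (1 / 4) (e n.+2 ^+ 2).
Proof.
move=> nb an; pose K := Num.truncn (e n.+2)^-1.
have eV : 1 <= (e n.+2)^-1 by rewrite invf_ge1 ?(le_trans (e_le_half _))//; lra.
have K0 : (0 < K)%N by rewrite truncn_gt0.
have en2 := e_gt0 n.+2.
(* Index [m * K + j] with [j < K] encodes the point [j%:R * e m.+2]; [K] is large enough for every
   [m <= n]. Each interval costs [e n.+2 ^+ 4], and the factors [n.+1] and [K] each absorb one power
   of [e n.+2]. *)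
apply: (@has_cover_itv _ _ _ _ _ _ (n.+1 * K)
  (fun i => (i %% K)%:R * e (i %/ K).+2)) => //.
- by rewrite exprn_ge0 ?e_ge0.
- rewrite -(powR_mulrn 16) ?e_ge0// -powRrM (_ : 16%:R * (1 / 4) = 4%:R);
    last by lra.
  rewrite powR_mulrn ?e_ge0//.
  have Ke : K%:R * e n.+2 <= 1.
    by rewrite -ler_pdivlMr// mul1r truncn_le; lra.
  have ne : n.+1%:R * e n.+2 <= 1.
    apply: le_trans (e_linear n); rewrite ler_pM2l ?ltr0Sn//.
    by apply: e_le; lia.
  have : (n.+1%:R * e n.+2) * (K%:R * e n.+2) <= 1.
    by rewrite mulr_ile1// mulr_ge0 ?e_ge0 ?ler0n.
  rewrite -(ler_pM2r (exprn_gt0 2 en2)) mul1r natrM; apply: le_trans.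
  by rewrite le_eqVlt; apply/orP; left; apply/eqP; ring.
move=> x [m mb mx]; have x0 := progression_ge0 mx.
have [mn|nm] := leqP m n.
  have [j jK ->] := progression_index mx.
  have jK' : (j < K)%N.
    by apply: leq_trans jK _; apply: le_truncn; rewrite lef_pV2 ?posrE// e_le.
  exists (m * K + j)%N.
    by apply: (@leq_trans (m.+1 * K));
      [rewrite mulSn; lia | rewrite leq_mul2r; lia].
  rewrite modnMDl divnMDl// (modn_small jK') (divn_small jK') addn0 lexx/=.
  by rewrite lerDl exprn_ge0 ?e_ge0.
(* Equal parity rules out [m = n.+1], so the interval at index 0 contains all of [progression m]. *)
have {}nm : (n.+2 <= m)%N.
  rewrite ltn_neqAle nm andbT; apply/eqP => nm'.
  by move: mb nb; rewrite -nm'/=; case: b; case: odd.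
exists 0%N; first by rewrite muln_gt0.
rewrite mod0n div0n mul0r add0r x0/=; case: mx => xm _.
by apply: le_trans xm _; rewrite ler_pXn2r ?nnegrE ?e_ge0// e_le.
Qed.

Lemma not_has_cover_progressions n a delta s : s < 1 / 2 -> e n.+2 <= a ->
  0 <= delta <= e n ^+ 36 ->
  ~ has_cover (progressions false `|` progressions true) a delta s 1.
Proof.
move=> s2 ena /andP[delta0 deltan].
have en := e_gt0 n; have en2 := e_gt0 n.+2; have enh := e_le_half n.
have a0 : 0 < a := lt_le_trans en2 ena.
have delta1 : delta <= 1.
  by apply: le_trans deltan _; rewrite exprn_ile1 ?e_ge0//; lra.
move=> /(has_cover_le_exponent a0 delta1 (ltW s2)).
(* The successor counts the term 0 and makes [N%:R * e n.+2] exceed [e n ^+ 16]. *)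
pose N := (Num.truncn (e n ^+ 16 / e n.+2)).+1.
have q0 : 0 <= e n ^+ 16 / e n.+2 by rewrite divr_ge0 ?exprn_ge0 ?e_ge0.
have prog j : (j < N)%N ->
    (progressions false `|` progressions true) (j%:R * e n.+2).
  move=> jN; suff nj : progression n (j%:R * e n.+2).
    by case nb: (odd n); [right|left]; exists n.
  split; last by exists j.
  by rewrite -ler_pdivlMr// -truncn_ge_nat.
have s1 : 1 / 2 <= 1 :> R by lra.
move=> /(progression_cover_cost en2 ena s1 prog); rewrite mulr1.
have Nn : e n ^+ 16 < N%:R * e n.+2.
  by rewrite -ltr_pdivrMr//; have /andP[] := truncn_itv q0.
move=> /(lt_le_trans Nn).
(* Half of the exponent 36 exceeds 16 by 2, and [e n ^+ 2 <= 1 / 4] beats the factor 2 in the cost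
   bound. *)
have : delta `^ (1 - 1 / 2) <= e n ^+ 18.
  rewrite -(powR_mulrn 18) ?e_ge0// (_ : 18%:R = 36%:R * (1 - 1 / 2) :> R);
    last by lra.
  rewrite powRrM powR_mulrn ?e_ge0// ge0_ler_powR ?nnegrE//;
    rewrite ?exprn_ge0//; lra.
rewrite (_ : 18%N = (16 + 2)%N)// exprD.
have : 0 < e n ^+ 16 by rewrite exprn_gt0.
have : e n ^+ 2 <= 1 / 4 by rewrite expr2; nra.
by move: (delta `^ _) (e n ^+ 16) (e n ^+ 2) => x y z; nra.
Qed.

Lemma scale_bracket delta : 0 < delta -> delta <= e 0%N ^+ 36 ->
  exists n, e n.+1 ^+ 36 <= delta <= e n ^+ 36.
Proof.
move=> d0 de0; have ex : exists n, e n ^+ 36 <= delta.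
  have [n en] := e_small d0; exists n.
  exact: le_trans (eX_le n 35) (ltW (en _ (leqnn n))).
(* The predecessor of the least such index is the bracket; if that index is 0, then [delta] equals
   [e 0 ^+ 36] and bracket 0 works. *)
case: (ex_minnP ex) => -[|n] en nmin.
  exists 0%N; rewrite de0 andbT (le_trans _ en)//.
  by rewrite ler_pXn2r ?nnegrE ?e_ge0 ?e_le.
exists n; rewrite en/= leNgt; apply/negP => /ltW/nmin.
by rewrite ltnn.
Qed.

(** * Lower dimensions of E, F and their union *)

Context (Delta : R) (Phi : R -> R).
Hypothesis Phi_adm : admissible Delta Phi.
Hypothesis e0_Delta : e 0%N < Delta.
Hypothesis Phi_e : forall n delta,
  e n.+1 ^+ 36 <= delta -> delta < Delta -> e n.+2 <= Phi delta.

Lemma lower_intermediate_dim_progressions_le b :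
  (lower_intermediate_dim Delta Phi (progressions b) <= (1 / 4)%:E)%E.
Proof.
apply: ereal_inf_lbound; exists (1 / 4) => //; split=> //.
move=> eps delta0 eps0 /andP[d0 _].
have [n0 en0] : exists n0, forall n, (n0 <= n)%N -> e n < Order.min eps delta0.
  by apply: e_small; rewrite lt_min eps0.
(* An index of parity [b] beyond [n0]. *)
pose n := (b + n0.*2)%N.
have nb : odd n = b by rewrite oddD odd_double addbF; case: b @n.
have : e n.+2 < Order.min eps delta0 by apply: en0; rewrite /n -addnn; lia.
rewrite lt_min => /andP[eneps end0].
have enD : e n.+2 ^+ 16 < Delta.
  by apply: le_lt_trans (eX_le _ _) (le_lt_trans (e_le (leq0n _)) e0_Delta).
have en16 : 0 < e n.+2 ^+ 16 by rewrite exprn_gt0.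
exists (e n.+2 ^+ 16); split=> //.
  by rewrite en16/=; apply: le_lt_trans (eX_le _ _) end0.
have [_ _ /(_ (e n.+2 ^+ 16)) Phin _] := Phi_adm.
have PhiD : Phi (e n.+2 ^+ 16) <= e n.+2 ^+ 16.
  by move: Phin; rewrite in_itv/= en16 enD => /(_ isT)/andP[].
have [D [U [FU dU sU]]] := has_cover_progressions nb PhiD.
exists D, U; split=> //; apply: le_trans sU _.
by rewrite lee_fin (le_trans (eX_le _ 1)) ?ltW.
Qed.

Lemma lower_intermediate_dim_progressionsU_ge :
  ((1 / 2)%:E <= lower_intermediate_dim Delta Phi
    (progressions false `|` progressions true))%E.
Proof.
apply: le_ereal_inf_tmp => _ [s [s0 hs] <-].
rewrite lee_fin leNgt; apply/negP => s2.
have e036 : 0 < e 0%N ^+ 36 <= 1.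
  by rewrite exprn_gt0//= (le_trans (eX_le _ _))//; have := e0_le; lra.
have [delta [/andP[d0 de] dD]] := hs 1 _ ltr01 e036.
have [n /andP[en1 en]] := scale_bracket d0 (ltW de).
apply: (not_has_cover_progressions s2 (Phi_e en1 dD)).
by rewrite ltW.
Qed.

End SparseProgressions.

(** A non-increasing [Phi] would stay above [Phi (Delta / 2) > 0] near 0, against [Phi x <= x]. *)
Lemma admissible_nondecreasing (R : realType) (Delta : R) (Phi : R -> R) :
  admissible Delta Phi -> {in `]0, Delta[ &, {homo Phi : x y / x <= y}}.
Proof.
move=> [D0 [//|Phi_decr] Phi_le _].
have inD x : 0 < x -> x <= Delta / 2 -> x \in `]0, Delta[.
  by move=> x0 xD; rewrite in_itv/= x0/=; lra.
have D2 : Delta / 2 \in `]0, Delta[ by apply: inD; lra.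
have /andP[P0 _] := Phi_le _ D2.
set P := Phi (Delta / 2) in P0.
have m0 : 0 < Order.min (Delta / 2) (P / 2) by rewrite lt_min; lra.
have mD : Order.min (Delta / 2) (P / 2) <= Delta / 2 by rewrite ge_min lexx.
have mP : Order.min (Delta / 2) (P / 2) <= P / 2 by rewrite ge_min lexx orbT.
have inm := inD _ m0 mD.
have /andP[_ Pm] := Phi_le _ inm.
by have := Phi_decr _ _ D2 inm mD; rewrite -/P; lra.
Qed.

(** Halving follows from [Phi x <= x]; the last property is monotonicity of [Phi], since [e n.+2] is
    its value at [e n.+1 ^+ 36]. *)
Lemma scales_exist (R : realType) (Delta : R) (Phi : R -> R) :
  admissible Delta Phi -> exists e : nat -> R,
  [/\ forall n, 0 < e n, e 0%N <= 1 / 2 /\ e 0%N < Delta,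
      forall n, e n.+1 <= e n / 2 &
      forall n delta, e n.+1 ^+ 36 <= delta -> delta < Delta ->
        e n.+2 <= Phi delta].
Proof.
move=> Phi_adm; have Phi_incr := admissible_nondecreasing Phi_adm.
have [D0 _ Phi_le _] := Phi_adm.
pose e0 := Order.min (1 / 2) (Delta / 2).
have e00 : 0 < e0 by rewrite lt_min; lra.
have e02 : e0 <= 1 / 2 by rewrite ge_min lexx.
have e0D : e0 < Delta.
  by apply: (@le_lt_trans _ _ (Delta / 2)); [rewrite ge_min lexx orbT | lra].
pose e n := iter n (fun x => Phi (x ^+ 36)) e0.
have X36 x : 0 < x -> x <= 1 / 2 -> x < Delta ->
    (x ^+ 36 \in `]0, Delta[) /\ x ^+ 36 <= x / 2.
  move=> x0 x2 xD.
  have : x ^+ 36 <= x / 2.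
    rewrite exprS ler_pM2l// exprS.
    have := exprn_ile1 34 (ltW x0) ltac:(lra); have := exprn_gt0 34 x0.
    by move: (x ^+ 34) => y; nra.
  by split=> //; rewrite in_itv/= exprn_gt0//=; lra.
(* Proved jointly: the first three bounds keep [e n ^+ 36] in the domain of [Phi], which the fourth
   requires. *)
have eP n : [/\ 0 < e n, e n <= 1 / 2, e n < Delta & e n.+1 <= e n / 2].
  elim: n => [|n [en0 en2 enD eh]].
    have [inD le2] := X36 _ e00 e02 e0D.
    by split=> //=; apply: le_trans le2; have /andP[] := Phi_le _ inD.
  have [inD le2] := X36 _ en0 en2 enD.
  have en10 : 0 < e n.+1 by have /andP[] := Phi_le _ inD.
  have [en12 en1D] : e n.+1 <= 1 / 2 /\ e n.+1 < Delta by lra.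
  have [inD1 le21] := X36 _ en10 en12 en1D.
  by split=> //; apply: le_trans le21; have /andP[] := Phi_le _ inD1.
exists e; split=> [n| |n|n delta en dD]; try by case: (eP n).
  by [].
have [en0 en2 enD _] := eP n.+1; have [inD _] := X36 _ en0 en2 enD.
apply: Phi_incr => //; rewrite in_itv/= dD andbT.
exact: lt_le_trans (exprn_gt0 36 en0) en.
Qed.

Theorem proposition5p5 (R : realType) (Delta : R) (Phi : R -> R)
    (Phi_adm : admissible Delta Phi) :
  (forall X : metricType R,
     uniformly_perfect X -> (exists x y : X, x <> y) ->
     forall E F : set X,
       E !=set0 -> totally_bounded E -> F !=set0 -> totally_bounded F ->
       upper_intermediate_dim Delta Phi (E `|` F) =
       Order.max (upper_intermediate_dim Delta Phi E)
                 (upper_intermediate_dim Delta Phi F)) /\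
  (exists E F : set R^o,
     [/\ E !=set0, compact E, F !=set0, compact F &
       (Order.max (lower_intermediate_dim Delta Phi E)
                  (lower_intermediate_dim Delta Phi F) <
        lower_intermediate_dim Delta Phi (E `|` F))%E]).
Proof.
split=> [X _ _ E F _ _ _ _|]; first exact: upper_intermediate_dimU.
have [e [e_gt0 [e0_le e0_Delta] e_half Phi_e]] := scales_exist Phi_adm.
exists (progressions e false), (progressions e true); split.
- by exists 0; exact: progressions0.
- exact: compact_progressions.
- by exists 0; exact: progressions0.
- exact: compact_progressions.
apply: (@lt_le_trans _ _ (1 / 2)%:E); last first.
  exact: lower_intermediate_dim_progressionsU_ge.
apply: (@le_lt_trans _ _ (1 / 4)%:E); last by rewrite lte_fin; lra.
by rewrite ge_max !lower_intermediate_dim_progressions_le.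
Qed.
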